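(* Let $s,y>0$ and consider $N(1,1)=\mathrm{SU}(3)/S^1$ with the metric $g_{s,y}$. Among the algebraic $3$-forms $$\mathrm{T}=\alpha X_{135}+\beta X_{146}+\gamma X_{245}+\delta X_{236}+\mu X_{127}+\nu X_{347}+\eta X_{567}$$ on $\mathfrak{m}$ ($\alpha,\dots,\eta\in\mathbb{R}$), the spinor field $\psi_5$ satisfies the equation $\nabla^g_X\psi_5+(X\lrcorner\,\mathrm{T})\cdot\psi_5=0$ (for all $X$) exactly for one $3$-form $\mathrm{T}=\mathrm{T}_5$, namely $$\mathrm{T}_5=\Big[\tfrac16+\tfrac y{12}+\tfrac{y-1}{6s}\Big][X_{135}+X_{146}+X_{245}-X_{236}]+\Big[\tfrac23-\tfrac{2y}3-\tfrac{2y+1}{6s}\Big]X_{127}+\Big[\tfrac13-\tfrac y3-\tfrac{4-y}{12s}\Big][X_{347}-X_{567}].$$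
   Context: $S^1\subset\mathrm{SU}(3)$ is embedded by $e^{i\theta}\mapsto\mathrm{diag}(e^{i\theta},e^{i\theta},e^{-2i\theta})$. Let $E_{ij}$ ($i<j$) be the matrix with $1$ at place $(i,j)$ and zero elsewhere, $A_{ij}=E_{ij}-E_{ij}^t$, $\tilde A_{ij}=i(E_{ij}+E_{ij}^t)$, $L=\mathrm{diag}(3i,-3i,0)$; $\mathfrak{m}_0=\mathrm{Lin}\{L\}$, $\mathfrak{m}_1=\mathrm{Lin}\{A_{12},\tilde A_{12}\}$, $\mathfrak{m}_2=\mathrm{Lin}\{A_{13},\tilde A_{13}\}$, $\mathfrak{m}_3=\mathrm{Lin}\{A_{23},\tilde A_{23}\}$. Then $\mathfrak{su}(3)=\mathfrak{m}\oplus\mathbb{R}$ with $\mathfrak{m}=\mathfrak{m}_0\oplus\mathfrak{m}_1\oplus\mathfrak{m}_2\oplus\mathfrak{m}_3$. With $B(X,Y)=-\frac12\mathrm{Re}\,\mathrm{tr}(XY)$, the $\mathrm{SU}(3)$-invariant metric is $g=g_{s,y}=\frac1{s^2}B|_{\mathfrak{m}_0}+B|_{\mathfrak{m}_1}+\frac1yB|_{\mathfrak{m}_2}+\frac1yB|_{\mathfrak{m}_3}$. An orthonormal basis of $\mathfrak{m}$ is $X_1=A_{12}$, $X_2=\tilde A_{12}$, $X_3=\sqrt yA_{13}$, $X_4=\sqrt y\tilde A_{13}$, $X_5=\sqrt yA_{23}$, $X_6=\sqrt y\tilde A_{23}$, $X_7=sL/3$; $X_{ijk}:=X_i\wedge X_j\wedge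 X_k$. $\lrcorner$ is the interior product. Spinors: $\Delta_7=\mathbb{R}^8$ with basis $\psi_1,\dots,\psi_8$. Let $F_{ij}$ be the skew endomorphism $\psi_i\mapsto\psi_j$, $\psi_j\mapsto-\psi_i$, other $\psi_k\mapsto0$. Clifford multiplication by $X_i$ is $e_i$, where $e_1=F_{18}+F_{27}-F_{36}-F_{45}$, $e_2=-F_{17}+F_{28}+F_{35}-F_{46}$, $e_3=-F_{16}+F_{25}-F_{38}+F_{47}$, $e_4=-F_{15}-F_{26}-F_{37}-F_{48}$, $e_5=-F_{13}-F_{24}+F_{57}+F_{68}$, $e_6=F_{14}-F_{23}-F_{58}+F_{67}$, $e_7=F_{12}-F_{34}-F_{56}+F_{78}$; $X_i\wedge X_j$ ($i\ne j$) acts as $e_i e_j$. The spinors $\psi_3,\psi_4,\psi_5,\psi_6$ are fixed by the lifted isotropy representation and define constant sections of the spinor bundle $S=\mathrm{SU}(3)\times_{\widetilde{\mathrm{Ad}}}\Delta_7$. For such a constant section $\psi$, $\nabla^g_{X}\psi=\tilde\Lambda(X)\psi$, where the lift $\tilde\Lambda:\mathfrak{m}\to\mathfrak{spin}(7)$ of the Levi-Civita connection is $\tilde\Lambda(X_1)=\frac1{2s}e_2e_7-[\frac12-\frac y4](e_3e_5+e_4e_6)$, $\tilde\Lambda(X_2)=-\frac1{2s}e_1e_7-[\frac12-\frac y4](e_4e_5-e_3e_6)$, $\tilde\Lambda(X_3)=\frac y{4s}e_4e_7-\frac y4(e_2e_6-e_1e_5)$, $\tilde\Lambda(X_4)=-\frac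 y{4s}e_3e_7+\frac y4(e_1e_6+e_2e_5)$, $\tilde\Lambda(X_5)=-\frac y{4s}e_6e_7-\frac y4(e_1e_3+e_2e_4)$, $\tilde\Lambda(X_6)=\frac y{4s}e_5e_7-\frac y4(e_1e_4-e_2e_3)$, $\tilde\Lambda(X_7)=\frac s2(2e_1e_2+e_3e_4-e_5e_6)-\frac1{2s}e_1e_2-\frac y{4s}e_3e_4+\frac y{4s}e_5e_6$. *)

(* Defs.v *)
From HB Require Import structures.
From mathcomp Require Import all_boot all_order all_algebra.
From mathcomp Require Import complex.
From mathcomp Require Import all_classical all_reals all_analysis.
From mathcomp Require Import ring lra.

Set Implicit Arguments.
Unset Strict Implicit.
Unset Printing Implicit Defensive.

Import Order.TTheory GRing.Theory Num.Theory.
Import numFieldNormedType.Exports.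

Local Open Scope classical_set_scope.
Local Open Scope ring_scope.

(* All numerical indices below (of matrix entries, frame vectors, basis        *)
(* spinors and Clifford generators) start at 1, as in the usual notation;      *)
(* entry (k, l) of a MathComp matrix is therefore tested as (k.+1, l.+1).      *)

Section LieAlgebra.
Variable R : realType.
Notation C := R[i].
Notation M3 := 'M[C]_3.

Definition E (i j : nat) : M3 :=
  \matrix_(k, l) ((k.+1 == i) && (l.+1 == j))%:R.

Definition A (i j : nat) : M3 := E i j - (E i j)^T.

Definition At (i j : nat) : M3 := 'i%C *: (E i j + (E i j)^T).

Definition L : M3 := ('i%C *+ 3) *: (E 1 1 - E 2 2).

(* real linear span; 'M[C]_3 is only canonically a complex vector space *)
Definition Lin (vs : seq M3) (X : M3) : Prop :=
  exists c : nat -> R, X = \sum_(k < size vs) (c k)%:C%C *: vs`_k.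

Definition in_m0 : M3 -> Prop := Lin [:: L].
Definition in_m1 : M3 -> Prop := Lin [:: A 1 2; At 1 2].
Definition in_m2 : M3 -> Prop := Lin [:: A 1 3; At 1 3].
Definition in_m3 : M3 -> Prop := Lin [:: A 2 3; At 2 3].

Definition in_m (X : M3) : Prop :=
  exists X0 X1 X2 X3 : M3,
    [/\ in_m0 X0, in_m1 X1, in_m2 X2, in_m3 X3 & X = X0 + X1 + X2 + X3].

(* stands for the tangent space of SU(3)/S^1 at the base point *)
Record mvec := Mvec { mval :> M3; mvalP : in_m mval }.

(* On m, pr0 is the projection to m_0 and pr 1 2, pr 1 3, pr 2 3 are the       *)
(* projections to m_1, m_2, m_3.                                               *)
Definition pr0 (X : M3) : M3 :=
  \matrix_(k, l) (if k == l then X k l else 0).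

Definition pr (i j : nat) (X : M3) : M3 :=
  \matrix_(k, l)
    (if ((k.+1 == i) && (l.+1 == j)) || ((k.+1 == j) && (l.+1 == i))
     then X k l else 0).

Definition B (X Y : M3) : R := - 2^-1 * complex.Re (\tr (X *m Y)).

Definition g (s y : R) (X Y : M3) : R :=
  (s ^+ 2)^-1 * B (pr0 X) (pr0 Y) + B (pr 1 2 X) (pr 1 2 Y)
  + y^-1 * B (pr 1 3 X) (pr 1 3 Y) + y^-1 * B (pr 2 3 X) (pr 2 3 Y).

Definition Xmx (s y : R) (i : nat) : M3 :=
  match i with
  | 1 => A 1 2
  | 2 => At 1 2
  | 3 => (Num.sqrt y)%:C%C *: A 1 3
  | 4 => (Num.sqrt y)%:C%C *: At 1 3
  | 5 => (Num.sqrt y)%:C%C *: A 2 3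
  | 6 => (Num.sqrt y)%:C%C *: At 2 3
  | 7 => (s / 3)%:C%C *: L
  | _ => 0
  end.

Lemma Lin0 vs : Lin vs 0.
Proof. by exists (fun=> 0); rewrite big1 // => k _; rewrite scale0r. Qed.

Lemma Lin_nth vs (a : R) (i : nat) : (i < size vs)%N ->
  Lin vs (a%:C%C *: vs`_i).
Proof.
move=> lt_i; exists (fun k => if k == i then a else 0).
rewrite (bigD1 (Ordinal lt_i)) //= eqxx big1 ?addr0 // => k.
by rewrite -val_eqE /= => /negbTE ->; rewrite scale0r.
Qed.

Lemma Xmx_in_m s y i : in_m (Xmx s y i).
Proof.
have r1 (X : M3) : X = (1 : R)%:C%C *: X by rewrite scale1r.
case: i => [|[|[|[|[|[|[|[|i]]]]]]]] /=.
- by exists 0, 0, 0, 0; split; rewrite ?addr0 //; apply: Lin0.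
- exists 0, (A 1 2), 0, 0; split; rewrite ?addr0 ?add0r //; try exact: Lin0.
  by rewrite (r1 (A 1 2)); apply: (@Lin_nth [:: _; _] _ 0).
- exists 0, (At 1 2), 0, 0; split; rewrite ?addr0 ?add0r //; try exact: Lin0.
  by rewrite (r1 (At 1 2)); apply: (@Lin_nth [:: _; _] _ 1).
- exists 0, 0, ((Num.sqrt y)%:C%C *: A 1 3), 0.
  split; rewrite ?addr0 ?add0r //; try exact: Lin0.
  exact: (@Lin_nth [:: _; _] _ 0).
- exists 0, 0, ((Num.sqrt y)%:C%C *: At 1 3), 0.
  split; rewrite ?addr0 ?add0r //; try exact: Lin0.
  exact: (@Lin_nth [:: _; _] _ 1).
- exists 0, 0, 0, ((Num.sqrt y)%:C%C *: A 2 3).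
  split; rewrite ?addr0 ?add0r //; try exact: Lin0.
  exact: (@Lin_nth [:: _; _] _ 0).
- exists 0, 0, 0, ((Num.sqrt y)%:C%C *: At 2 3).
  split; rewrite ?addr0 ?add0r //; try exact: Lin0.
  exact: (@Lin_nth [:: _; _] _ 1).
- exists ((s / 3)%:C%C *: L), 0, 0, 0.
  split; rewrite ?addr0 //; try exact: Lin0.
  exact: (@Lin_nth [:: _] _ 0).
- by exists 0, 0, 0, 0; split; rewrite ?addr0 //; apply: Lin0.
Qed.

Definition X_ (s y : R) (i : nat) : mvec := Mvec (Xmx_in_m s y i).

End LieAlgebra.

(* R^o makes these function spaces real vector spaces (pointwise operations) *)
Notation form2 R := (mvec R -> mvec R -> R^o).
Notation form3 R := (mvec R -> mvec R -> mvec R -> R^o).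

Section Forms.
Variable R : realType.

(* X_i /\ X_j /\ X_k, vectors being identified with covectors through g; no    *)
(* factor 1/6, so that it takes the value 1 on (X_i, X_j, X_k)                 *)
Definition X3 (s y : R) (i j k : nat) : form3 R := fun U V W =>
  \det (\matrix_(p < 3, q < 3)
          g s y (Xmx s y (nth 0%N [:: i; j; k] p)) [:: mval U; mval V; mval W]`_q).

Definition interior_product (X : mvec R) (T : form3 R) : form2 R := T X.

Definition algebraic_form3 (s y : R) (T : form3 R) : Prop :=
  exists al be ga de mu nu et : R,
    T = al *: X3 s y 1 3 5 + be *: X3 s y 1 4 6 + ga *: X3 s y 2 4 5
      + de *: X3 s y 2 3 6 + mu *: X3 s y 1 2 7 + nu *: X3 s y 3 4 7
      + et *: X3 s y 5 6 7.

End Forms.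

Section Spinors.
Variable R : realType.

(* Spinors are column vectors, endomorphisms act by left multiplication.       *)
Notation Delta7 := 'cV[R]_8.
Notation End7 := 'M[R]_8.

Definition psi (i : nat) : Delta7 := \col_k (k.+1 == i)%:R.

Definition F (i j : nat) : End7 :=
  \matrix_(k, l) (((k.+1 == j) && (l.+1 == i))%:R
                  - ((k.+1 == i) && (l.+1 == j))%:R).

Definition e (i : nat) : End7 :=
  match i with
  | 1 => F 1 8 + F 2 7 - F 3 6 - F 4 5
  | 2 => - F 1 7 + F 2 8 + F 3 5 - F 4 6
  | 3 => - F 1 6 + F 2 5 - F 3 8 + F 4 7
  | 4 => - F 1 5 - F 2 6 - F 3 7 - F 4 8
  | 5 => - F 1 3 - F 2 4 + F 5 7 + F 6 8
  | 6 => F 1 4 - F 2 3 - F 5 8 + F 6 7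
  | 7 => F 1 2 - F 3 4 - F 5 6 + F 7 8
  | _ => 0
  end.

Definition cliff2 (s y : R) (w : form2 R) (v : Delta7) : Delta7 :=
  \sum_(1 <= i < 8) \sum_(i.+1 <= j < 8)
    w (X_ s y i) (X_ s y j) *: ((e i * e j) *m v).

(* Lift of the Levi-Civita connection of g to spin(7), on the frame ...        *)
Definition LambdaX (s y : R) (i : nat) : End7 :=
  match i with
  | 1 => (2 * s)^-1 *: (e 2 * e 7)
         - (2^-1 - y / 4) *: (e 3 * e 5 + e 4 * e 6)
  | 2 => - (2 * s)^-1 *: (e 1 * e 7)
         - (2^-1 - y / 4) *: (e 4 * e 5 - e 3 * e 6)
  | 3 => (y / (4 * s)) *: (e 4 * e 7) - (y / 4) *: (e 2 * e 6 - e 1 * e 5)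
  | 4 => - (y / (4 * s)) *: (e 3 * e 7) + (y / 4) *: (e 1 * e 6 + e 2 * e 5)
  | 5 => - (y / (4 * s)) *: (e 6 * e 7) - (y / 4) *: (e 1 * e 3 + e 2 * e 4)
  | 6 => (y / (4 * s)) *: (e 5 * e 7) - (y / 4) *: (e 1 * e 4 - e 2 * e 3)
  | 7 => (s / 2) *: (2 *: (e 1 * e 2) + e 3 * e 4 - e 5 * e 6)
         - (2 * s)^-1 *: (e 1 * e 2) - (y / (4 * s)) *: (e 3 * e 4)
         + (y / (4 * s)) *: (e 5 * e 6)
  | _ => 0
  end.

(* ... extended linearly to m. *)
Definition Lambda (s y : R) (X : mvec R) : End7 :=
  \sum_(1 <= i < 8) g s y X (X_ s y i) *: LambdaX s y i.

End Spinors.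

Section SpinorFields.
Variable R : realType.
Notation C := R[i].
Notation M3 := 'M[C]_3.
Notation Delta7 := 'cV[R]_8.
Notation End7 := 'M[R]_8.

Definition SU3 (p : M3) : Prop :=
  p *m (map_mx (@conjc R) p)^T = 1%:M /\ \det p = 1.

Definition cis (t : R) : C := (cos t +i* sin t)%C.

Definition S1_embed (t : R) : M3 :=
  \matrix_(k, l) (if k == l then cis (if k.+1 == 3%N then - (2 * t) else t)
                  else 0).

(* The isotropy representation Ad(S1_embed t) on m fixes X_1, X_2, X_7 and     *)
(* rotates the planes (X_3, X_4) and (X_5, X_6) by the angle 3t. Its lift to   *)
(* Spin(7) is the product of the two half-angle rotors, which has period 2 pi. *)
Definition rotor (phi : R) (i j : nat) : End7 :=
  cos (phi / 2) *: 1 + sin (phi / 2) *: (e R i * e R j).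

Definition isotropy_lift (t : R) : End7 :=
  rotor (3 * t) 3 4 * rotor (3 * t) 5 6.

(* Sections of SU(3) x_{S^1} Delta_7 as equivariant maps; only the values on   *)
(* SU(3) are meaningful.                                                       *)
Record spinor_field := SpinorField {
  spinor_at :> M3 -> Delta7;
  spinor_equivariant : forall (p : M3) (t : R), SU3 p ->
    spinor_at (p *m S1_embed t) = isotropy_lift (- t) *m spinor_at p }.

Definition isotropy_fixed (v : Delta7) : Prop :=
  forall t, isotropy_lift t *m v = v.

Definition constant_field (v : Delta7) (fixv : isotropy_fixed v) :=
  @SpinorField (fun=> v) (fun p t _ => esym (fixv (- t))).

(* matrix exponential, entrywise limit of the partial sums *)
Definition expmx (Z : M3) : M3 :=
  \matrix_(k, l)
    let S n := (\sum_(j < n) (j`!%:R)^-1 *: Z ^+ j : M3) k l in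
    (limn (fun n => complex.Re (S n)) +i* limn (fun n => complex.Im (S n)))%C.

(* Levi-Civita derivative, at the point represented by p in SU(3) and in the   *)
(* direction X in m: the derivative of the equivariant map along the           *)
(* left-invariant field X plus the action of Lambda (X). On constant fields    *)
(* the first term vanishes.                                                    *)
Definition nabla (s y : R) (X : mvec R) (Psi : spinor_field) (p : M3) : Delta7
  := 'D_1 (fun t : R => Psi (p *m expmx (t%:C%C *: mval X))) (0 : R)
     + Lambda s y X *m Psi p.

Lemma mul_psi (M : End7) (k : 'I_8) : M *m psi R k.+1 = col k M.
Proof.
apply/matrixP => a b; rewrite !mxE (bigD1 k) //= !mxE eqxx mulr1.
rewrite big1 ?addr0 // => l; rewrite -val_eqE /= => /negbTE lk.
by rewrite !mxE eqSS lk mulr0.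
Qed.

Lemma isotropy_fixed_psi5 : isotropy_fixed (psi R 5).
Proof.
have E45 : e R 4 *m psi R 5 = psi R 1.
  rewrite (mul_psi _ (@Ordinal 8 4 isT)); apply/matrixP => -[i Hi] j.
  by do 8?[case: i Hi => [|i] Hi //=]; rewrite !mxE /=; ring.
have E31 : e R 3 *m psi R 1 = - psi R 6.
  rewrite (mul_psi _ (@Ordinal 8 0 isT)); apply/matrixP => -[i Hi] j.
  by do 8?[case: i Hi => [|i] Hi //=]; rewrite !mxE /=; ring.
have E65 : e R 6 *m psi R 5 = - psi R 8.
  rewrite (mul_psi _ (@Ordinal 8 4 isT)); apply/matrixP => -[i Hi] j.
  by do 8?[case: i Hi => [|i] Hi //=]; rewrite !mxE /=; ring.
have E58 : e R 5 *m psi R 8 = - psi R 6.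
  rewrite (mul_psi _ (@Ordinal 8 7 isT)); apply/matrixP => -[i Hi] j.
  by do 8?[case: i Hi => [|i] Hi //=]; rewrite !mxE /=; ring.
have E46 : e R 4 *m psi R 6 = psi R 2.
  rewrite (mul_psi _ (@Ordinal 8 5 isT)); apply/matrixP => -[i Hi] j.
  by do 8?[case: i Hi => [|i] Hi //=]; rewrite !mxE /=; ring.
have E32 : e R 3 *m psi R 2 = psi R 5.
  rewrite (mul_psi _ (@Ordinal 8 1 isT)); apply/matrixP => -[i Hi] j.
  by do 8?[case: i Hi => [|i] Hi //=]; rewrite !mxE /=; ring.
have P M N v : (M * N : End7) *m v = M *m (N *m v).
  by rewrite (mulmxA M N v).
move=> t; rewrite /isotropy_lift /rotor P !mulmxDl -!scalemxAl !P !mul1mx.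
rewrite E65 mulmxN E58 opprK !mulmxDr -!scalemxAr E45 E31 E46 E32.
have /= := cos2Dsin2 (3 * t / 2).
move: (cos _) (sin _) => c d cd.
rewrite -[RHS]scale1r -cd.
by apply/matrixP => i j; rewrite !mxE; ring.
Qed.

Definition psi5 : spinor_field := constant_field isotropy_fixed_psi5.

End SpinorFields.

(* Main.v *)
Require Import Defs.
From mathcomp Require Import all_boot all_order all_algebra.
From mathcomp Require Import complex.
From mathcomp Require Import all_classical all_reals all_analysis.
From mathcomp Require Import ring lra.
Import Order.TTheory GRing.Theory Num.Theory.
Local Open Scope ring_scope.

(** The equation is linear in X, and only finitely many numbers enter it.
    The frame X_1, ..., X_7 is orthonormal for g, so every vector X enters the
    connection and the contractions X _| X_ijk only through its coordinates
    g (X, X_n); in particular, contracting by X acts on spinors as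
      x_i e_j e_k - x_j e_i e_k + x_k e_i e_j   (x_n = g (X, X_n))
    [cliff2_interior_X3].

    The seven triples (i, j, k) that occur in T form a Fano plane: each frame
    vector X_n lies in three of them, and the three complementary pairs
    multiply psi_5 to plus or minus one and the same basis spinor
    psi_{target n} [e_e_psi5].  The pairs occurring in the lift Lambda (X_n) of
    the Levi-Civita connection are among these three.  Since psi_5 is
    constant, the left-hand side of the equation is therefore
      sum over n of g (X, X_n) * c_n * psi_{target n},
    with one scalar c_n per frame vector, affine in the seven coefficients of
    T [killing_lhs].  Evaluating at X = X_n shows that the equation holds for
    all X exactly when the seven scalars c_n vanish [killing_iff].

    These are seven linear equations in seven unknowns.  The homogeneous
    equations 1 to 6 force (al, be, ga, -de) = (q, q, q, q) and
    (mu, nu, et) = (-2q, 2q, -2q), and equation 7 then reads -6q = 0: the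
    system is regular.  Its solution is the list of coefficients of T_5
    [killing_coefs_eq0]. *)

(** * The orthonormal frame *)

Lemma g_sym (R : realType) (s y : R) X Y : g s y X Y = g s y Y X.
Proof.
have BC (U V : 'M[R[i]]_3) : B U V = B V U by rewrite /B mxtrace_mulC.
by rewrite /g (BC (pr0 X)) !(BC (pr _ _ X)).
Qed.

(** Splitting complex entries into real and imaginary parts turns identities
    involving g into identities of rational functions over R. *)
Lemma g_entries (R : realType) (s y : R) (X Y : 'M[R[i]]_3) :
  let i0 : 'I_3 := inord 0 in
  let i1 : 'I_3 := inord 1 in
  let i2 : 'I_3 := inord 2 in
  let h i j := complex.Re (X i j) * complex.Re (Y j i)
             - complex.Im (X i j) * complex.Im (Y j i) in
  g s y X Y =
    - 2^-1 * ((s ^+ 2)^-1 * (h i0 i0 + h i1 i1 + h i2 i2)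
              + (h i0 i1 + h i1 i0)
              + y^-1 * (h i0 i2 + h i2 i0 + h i1 i2 + h i2 i1)).
Proof.
move=> i0 i1 i2 h.
rewrite /g /B /mxtrace !big_ord_recl !big_ord0 !mxE !big_ord_recl !big_ord0.
rewrite !mxE.
have -> : lift ord0 (lift ord0 ord0) = i2 by apply: val_inj; rewrite /= inordK.
have -> : lift ord0 ord0 = i1 by apply: val_inj; rewrite /= inordK.
have -> : ord0 = i0 by apply: val_inj; rewrite /= inordK.
rewrite /i0 /i1 /i2 -!val_eqE /= !inordK //= /h.
case: (X i0 i0) (X i0 i1) (X i0 i2) (X i1 i0) (X i1 i1) (X i1 i2) (X i2 i0)
  (X i2 i1) (X i2 i2) => [? ?] [? ?] [? ?] [? ?] [? ?] [? ?] [? ?] [? ?] [? ?].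
case: (Y i0 i0) (Y i0 i1) (Y i0 i2) (Y i1 i0) (Y i1 i1) (Y i1 i2) (Y i2 i0)
  (Y i2 i1) (Y i2 i2) => [? ?] [? ?] [? ?] [? ?] [? ?] [? ?] [? ?] [? ?] [? ?].
by rewrite /=; ring.
Qed.

(** The coordinate along X_i, valid for an arbitrary matrix Y: it depends only
    on the skew-Hermitian part of Y. *)
Definition coord {R : realType} (s y : R) (i : nat) (Y : 'M[R[i]]_3) : R :=
  let i0 : 'I_3 := inord 0 in
  let i1 : 'I_3 := inord 1 in
  let i2 : 'I_3 := inord 2 in
  let re_skew k l := complex.Re (Y k l) - complex.Re (Y l k) in
  let im_sym k l := complex.Im (Y k l) + complex.Im (Y l k) in
  match i with
  | 1 => re_skew i0 i1 / 2
  | 2 => im_sym i0 i1 / 2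
  | 3 => re_skew i0 i2 / (2 * Num.sqrt y)
  | 4 => im_sym i0 i2 / (2 * Num.sqrt y)
  | 5 => re_skew i1 i2 / (2 * Num.sqrt y)
  | 6 => im_sym i1 i2 / (2 * Num.sqrt y)
  | _ => (complex.Im (Y i0 i0) - complex.Im (Y i1 i1)) / (2 * s)
  end.

Lemma g_Xmx (R : realType) (s y : R) (i : nat) Y :
    0 < s -> 0 < y -> (0 < i < 8)%N -> g s y (Xmx s y i) Y = coord s y i Y.
Proof.
move=> s_gt0 y_gt0.
have r_neq0 : Num.sqrt y != 0 by rewrite gt_eqF ?sqrtr_gt0.
have s_neq0 : s != 0 by rewrite gt_eqF.
rewrite g_entries /coord -[y^-1](congr1 GRing.inv (sqr_sqrtr (ltW y_gt0))).
case: i => [|[|[|[|[|[|[|[|i]]]]]]]] // _.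
all: rewrite !mxE ?inordK //=.
all: move: (Num.sqrt y) r_neq0 => r r_neq0.
all: by field; rewrite ?r_neq0 ?s_neq0.
Qed.

Lemma g_frame (R : realType) (s y : R) (i j : nat) :
    0 < s -> 0 < y -> (0 < i < 8)%N -> (0 < j < 8)%N ->
  g s y (Xmx s y i) (Xmx s y j) = (i == j)%:R.
Proof.
move=> s_gt0 y_gt0 range_i range_j; rewrite g_Xmx //.
have r_neq0 : Num.sqrt y != 0 by rewrite gt_eqF ?sqrtr_gt0.
have s_neq0 : s != 0 by rewrite gt_eqF.
case: j range_j => [|[|[|[|[|[|[|[|j]]]]]]]] // _;
  case: i range_i => [|[|[|[|[|[|[|[|i]]]]]]]] // _.
all: rewrite /coord !mxE ?inordK //=.
all: move: (Num.sqrt y) r_neq0 => r r_neq0.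
all: by field; rewrite ?r_neq0 ?s_neq0.
Qed.

(** * Contraction of a 3-form acting on spinors *)

Lemma cliff2D (R : realType) (s y : R) (w1 w2 : form2 R) v :
  cliff2 s y (w1 + w2) v = cliff2 s y w1 v + cliff2 s y w2 v.
Proof.
rewrite /cliff2 -big_split; apply: eq_bigr => i _.
by rewrite -big_split; apply: eq_bigr => j _; rewrite /= scalerDl.
Qed.

Lemma cliff2Z (R : realType) (s y : R) (a : R) (w : form2 R) v :
  cliff2 s y (a *: w) v = a *: cliff2 s y w v.
Proof.
rewrite /cliff2 scaler_sumr; apply: eq_bigr => i _.
by rewrite scaler_sumr; apply: eq_bigr => j _; rewrite scalerA.
Qed.

(** The minor of X_j /\ X_k picks out the pair (a, b) = (j, k): among pairs
    with a < b the transposed term never contributes. *)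
Lemma sum_minor (R : realType) (V : lmodType R) (w : nat -> nat -> V)
    (j k : nat) :
    (0 < j)%N -> (j < k)%N -> (k < 8)%N ->
  \sum_(1 <= a < 8) \sum_(a.+1 <= b < 8)
     ((j == a)%:R * (k == b)%:R - (k == a)%:R * (j == b)%:R : R) *: w a b = w j k.
Proof.
move=> j_gt0 lt_jk k_lt8.
have j_lt8 : (j < 8)%N by apply: ltn_trans k_lt8.
rewrite (bigD1_seq j) ?iota_uniq ?mem_index_iota ?j_gt0 //=.
rewrite (bigD1_seq k) ?iota_uniq ?mem_index_iota ?lt_jk //= !eqxx.
rewrite (gtn_eqF lt_jk) mul0r subr0 mulr1 scale1r.
rewrite !big1_seq ?addr0 // => a; rewrite mem_index_iota => /andP[neq range_a].
  (* only a = k, b = j could give a nonzero minor, but there b < a *)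
  rewrite big1_seq // => b; rewrite mem_index_iota => /andP[_ /andP[lt_ab _]].
  rewrite (eq_sym j a) (negbTE neq) mul0r sub0r -natrM mulnb.
  case: eqP => [ka|_]; last by rewrite oppr0 scale0r.
  by rewrite ltn_eqF ?oppr0 ?scale0r // (ltn_trans lt_jk) // ka.
by rewrite (eq_sym k a) (negbTE neq) mulr0 mul0r subr0 scale0r.
Qed.

Lemma det3 (R : comNzRingType) (f : nat -> nat -> R) :
  \det (\matrix_(p < 3, q < 3) f p q) =
    f 0%N 0%N * (f 1%N 1%N * f 2%N 2%N - f 2%N 1%N * f 1%N 2%N)
  - f 1%N 0%N * (f 0%N 1%N * f 2%N 2%N - f 2%N 1%N * f 0%N 2%N)
  + f 2%N 0%N * (f 0%N 1%N * f 1%N 2%N - f 1%N 1%N * f 0%N 2%N).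
Proof.
rewrite (expand_det_row _ ord0) !big_ord_recl big_ord0 /cofactor.
rewrite !(expand_det_row _ ord0) !big_ord_recl !big_ord0 /cofactor !det_mx11.
rewrite !mxE /= /bump /=; ring.
Qed.

Lemma X3E (R : realType) (s y : R) (i j k : nat) (U V W : mvec R) :
  X3 s y i j k U V W =
  let x n := g s y (Xmx s y n) U in
  let v n := g s y (Xmx s y n) V in
  let w n := g s y (Xmx s y n) W in
  x i * (v j * w k - v k * w j) - x j * (v i * w k - v k * w i)
  + x k * (v i * w j - v j * w i).
Proof.
pose f (p q : nat) : R :=
  g s y (Xmx s y (nth 0%N [:: i; j; k] p)) [:: mval U; mval V; mval W]`_q.
exact: det3 _ f.
Qed.

(** Expanding the determinant along X leaves 2 x 2 minors in frame vectors,
    which by orthonormality select a single product of generators each. *)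
Lemma cliff2_interior_X3 (R : realType) (s y : R) (i j k : nat) (X : mvec R) v :
    0 < s -> 0 < y -> (0 < i)%N -> (i < j)%N -> (j < k)%N -> (k < 8)%N ->
  let x n := g s y X (X_ s y n) in
  cliff2 s y (interior_product X (X3 s y i j k)) v =
    x i *: ((e R j * e R k) *m v) - x j *: ((e R i * e R k) *m v)
    + x k *: ((e R i * e R j) *m v).
Proof.
move=> s_gt0 y_gt0 i_gt0 lt_ij lt_jk k_lt8 x.
have frame n a : (0 < n < 8)%N -> (0 < a < 8)%N ->
    g s y (Xmx s y n) (X_ s y a) = (n == a)%:R by exact: g_frame.
have j_gt0 := ltn_trans i_gt0 lt_ij.
have k_gt0 := ltn_trans j_gt0 lt_jk.
have j_lt8 := ltn_trans lt_jk k_lt8.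
have i_lt8 := ltn_trans lt_ij j_lt8.
pose w a b := (e R a * e R b) *m v.
rewrite -[(e R j * _) *m v]/(w j k) -[(e R i * e R k) *m v]/(w i k).
rewrite -[(e R i * _) *m v]/(w i j).
rewrite -(sum_minor _ _ w j k) // -(sum_minor _ _ w i k) ?(ltn_trans lt_ij) //.
rewrite -(sum_minor _ _ w i j) // !scaler_sumr -sumrB -big_split.
apply: eq_big_nat => a range_a; rewrite !scaler_sumr -sumrB -big_split.
apply: eq_big_nat => b /andP[lt_ab b_lt8].
have b_gt0 : (0 < b)%N by apply: leq_trans lt_ab.
rewrite /interior_product X3E /= !frame ?i_gt0 ?j_gt0 ?k_gt0 ?b_gt0 //.
by rewrite !(g_sym _ s y (Xmx _ _ _) X) !scalerA -scalerBl -scalerDl.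
Qed.

(** * Clifford products on psi_5 *)

Lemma F_psi (R : realType) (i j k : nat) : (0 < k < 9)%N ->
  F R i j *m psi R k = (k == i)%:R *: psi R j - (k == j)%:R *: psi R i.
Proof.
move=> /andP[]; case: k => // k _; rewrite ltnS => k_lt.
rewrite (mul_psi _ (Ordinal k_lt)); apply/matrixP => l m; rewrite !mxE /=.
by rewrite -!mulnb !natrM mulrC [in X in _ - X = _]mulrC.
Qed.

Lemma mul_e2 (R : realType) (i j : nat) (v : 'cV[R]_8) :
  (e R i * e R j) *m v = e R i *m (e R j *m v).
Proof. by rewrite (mulmxA (e R i)). Qed.

Lemma e_psi5 (R : realType) :
  [/\ [/\ e R 2 *m psi R 5 = - psi R 3, e R 3 *m psi R 5 = - psi R 2
        & e R 4 *m psi R 5 = psi R 1],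
      e R 5 *m psi R 5 = psi R 7, e R 6 *m psi R 5 = - psi R 8
    & e R 7 *m psi R 5 = - psi R 6].
Proof.
split; [split| | |]; rewrite /= !(mulmxDl, mulNmx) !F_psi //=.
all: by rewrite !(scale0r, scale1r, subr0, sub0r, addr0, add0r, oppr0, opprK).
Qed.

(** The rows belong to X_1, ..., X_7 in this order: row n lists the pairs that
    complete n to one of the seven triples of T. *)
Lemma e_e_psi5 (R : realType) :
  [/\ [/\ (e R 2 * e R 7) *m psi R 5 = - psi R 4,
          (e R 3 * e R 5) *m psi R 5 = - psi R 4
        & (e R 4 * e R 6) *m psi R 5 = - psi R 4],
      [/\ (e R 1 * e R 7) *m psi R 5 = - psi R 3,
          (e R 4 * e R 5) *m psi R 5 = psi R 3
        & (e R 3 * e R 6) *m psi R 5 = - psi R 3],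
      [/\ (e R 4 * e R 7) *m psi R 5 = - psi R 2,
          (e R 2 * e R 6) *m psi R 5 = psi R 2
        & (e R 1 * e R 5) *m psi R 5 = - psi R 2],
      [/\ (e R 3 * e R 7) *m psi R 5 = - psi R 1,
          (e R 1 * e R 6) *m psi R 5 = psi R 1
        & (e R 2 * e R 5) *m psi R 5 = psi R 1]
    & [/\ [/\ (e R 6 * e R 7) *m psi R 5 = - psi R 7,
              (e R 1 * e R 3) *m psi R 5 = - psi R 7
            & (e R 2 * e R 4) *m psi R 5 = - psi R 7],
          [/\ (e R 5 * e R 7) *m psi R 5 = - psi R 8,
              (e R 1 * e R 4) *m psi R 5 = psi R 8
            & (e R 2 * e R 3) *m psi R 5 = - psi R 8]
        & [/\ (e R 1 * e R 2) *m psi R 5 = psi R 6,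
              (e R 3 * e R 4) *m psi R 5 = - psi R 6
            & (e R 5 * e R 6) *m psi R 5 = psi R 6]]].
Proof.
have [[e2 e3 e4] e5 e6 e7] := e_psi5 R.
split; split; try split; rewrite mul_e2.
all: rewrite ?(e2, e3, e4, e5, e6, e7) ?mulmxN.
all: rewrite /= !(mulmxDl, mulNmx) !F_psi //=.
all: by rewrite !(scale0r, scale1r, subr0, sub0r, addr0, add0r, oppr0, opprK).
Qed.

(** * The equation in coordinates *)

Definition form7 {R : realType} (s y al be ga de mu nu et : R) : form3 R :=
  al *: X3 s y 1 3 5 + be *: X3 s y 1 4 6 + ga *: X3 s y 2 4 5
  + de *: X3 s y 2 3 6 + mu *: X3 s y 1 2 7 + nu *: X3 s y 3 4 7
  + et *: X3 s y 5 6 7.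

(** The index of the basis spinor of which both Lambda (X_n) psi_5 and
    (X_n _| T) psi_5 are multiples. *)
Definition target (n : nat) : nat := nth 0%N [:: 4; 3; 2; 1; 7; 8; 6] n.-1.

Definition levi_civita_coef {R : realType} (s y : R) (n : nat) : R :=
  let a := 1 - y / 2 - (2 * s)^-1 in
  let b := y / 2 + y / (4 * s) in
  match n with
  | 1 => a | 2 => - a
  | 3 => - b | 4 => b | 5 => b | 6 => - b
  | _ => (y - 1) / (2 * s)
  end.

Definition torsion_coef {R : realType} (al be ga de mu nu et : R) (n : nat) : R :=
  match n with
  | 1 => - al - be - mu
  | 2 => ga - de + mu
  | 3 => al - de - nu
  | 4 => nu - be - ga
  | 5 => - al - ga - et
  | 6 => be - de + et
  | _ => mu - nu + et
  end.

Definition killing_coef {R : realType} (s y al be ga de mu nu et : R) (n : nat) : R :=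
  levi_civita_coef s y n + torsion_coef al be ga de mu nu et n.

Lemma LambdaX_psi5 (R : realType) (s y : R) (n : nat) :
    s != 0 -> (0 < n < 8)%N ->
  LambdaX s y n *m psi R 5 = levi_civita_coef s y n *: psi R (target n).
Proof.
move=> s_neq0.
have [[e27 e35 e46] [e17 e45 e36] [e47 e26 e15] [e37 e16 e25]
  [[e67 e13 e24] [e57 e14 e23] [e12 e34 e56]]] := e_e_psi5 R.
case: n => [|[|[|[|[|[|[|[|n]]]]]]]] //= _.
all: rewrite !(mulmxDl, mulNmx, scaleNr) -!scalemxAl !(mulmxDl, mulNmx).
all: rewrite -?scalemxAl.
all: rewrite ?(e27, e35, e46, e17, e45, e36, e47, e26, e15, e37, e16, e25,
  e67, e13, e24, e57, e14, e23, e12, e34, e56).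
all: by rewrite /target /=; apply/matrixP => k l; rewrite !mxE; field.
Qed.

(** Here f stands for the action of X _| T on psi_5 as a function of T, Y for
    the family of 3-forms X_ijk and x_n for g (X, X_n).  With these kept
    abstract, terms such as X_135 and X_146 are told apart by their indices
    instead of by evaluating determinants. *)
Lemma linear_form7 (R : realType) (V : lmodType R) (f : V -> 'cV[R]_8)
    (Y : nat -> nat -> nat -> V) (x : nat -> R) (al be ga de mu nu et : R) :
    let w i j := (e R i * e R j) *m psi R 5 in
    (forall u v, f (u + v) = f u + f v) ->
    (forall a u, f (a *: u) = a *: f u) ->
    (forall i j k, (0 < i)%N -> (i < j)%N -> (j < k)%N -> (k < 8)%N ->
       f (Y i j k) = x i *: w j k - x j *: w i k + x k *: w i j) ->
  f (al *: Y 1%N 3%N 5%N + be *: Y 1%N 4%N 6%N + ga *: Y 2%N 4%N 5%N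
     + de *: Y 2%N 3%N 6%N + mu *: Y 1%N 2%N 7%N + nu *: Y 3%N 4%N 7%N
     + et *: Y 5%N 6%N 7%N) =
  \sum_(1 <= n < 8)
     (x n * torsion_coef al be ga de mu nu et n) *: psi R (target n).
Proof.
move=> w fD fZ fY; rewrite !fD !fZ !fY // /w.
have [[-> -> ->] [-> -> ->] [-> -> ->] [-> -> ->]
  [[-> -> ->] [-> -> ->] [-> -> ->]]] := e_e_psi5 R.
do 7! rewrite big_ltn //; rewrite big_geq // /target /=.
by apply/matrixP => k l; rewrite !mxE; ring.
Qed.

Lemma cliff2_form7_psi5 (R : realType) (s y al be ga de mu nu et : R) X :
    0 < s -> 0 < y ->
  cliff2 s y (interior_product X (form7 s y al be ga de mu nu et)) (psi R 5) =
  \sum_(1 <= n < 8) (g s y X (X_ s y n) * torsion_coef al be ga de mu nu et n)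
    *: psi R (target n).
Proof.
move=> s_gt0 y_gt0.
apply: (linear_form7 _ _
  (fun T => cliff2 s y (interior_product X T) (psi R 5))
  (X3 s y) (fun n => g s y X (X_ s y n))).
- by move=> T1 T2; apply: cliff2D.
- by move=> a T; apply: cliff2Z.
- by move=> *; apply: cliff2_interior_X3.
Qed.

Lemma nabla_psi5 (R : realType) (s y : R) X p :
  nabla s y X (psi5 R) p = Lambda s y X *m psi R 5.
Proof. by rewrite /nabla [X in X + _](derive_cst (psi R 5)) add0r. Qed.

Lemma killing_lhs (R : realType) (s y al be ga de mu nu et : R) X p :
    0 < s -> 0 < y ->
  nabla s y X (psi5 R) p
    + cliff2 s y (interior_product X (form7 s y al be ga de mu nu et)) (psi5 R p) =
  \sum_(1 <= n < 8)
    (g s y X (X_ s y n) * killing_coef s y al be ga de mu nu et n)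
    *: psi R (target n).
Proof.
move=> s_gt0 y_gt0; rewrite nabla_psi5 [psi5 R p]/(psi R 5).
rewrite cliff2_form7_psi5 // /Lambda mulmx_suml -big_split.
apply: eq_big_nat => n range_n /=.
by rewrite -scalemxAl LambdaX_psi5 ?gt_eqF // scalerA -scalerDl -mulrDr.
Qed.

(** At X = X_n only the n-th term survives, and psi_{target n} is nonzero. *)
Lemma killing_iff (R : realType) (s y al be ga de mu nu et : R) :
    0 < s -> 0 < y ->
  (forall (p : 'M[R[i]]_3) (X : mvec R), SU3 p ->
    nabla s y X (psi5 R) p
    + cliff2 s y (interior_product X (form7 s y al be ga de mu nu et)) (psi5 R p)
    = 0)
  <-> (forall n, (0 < n < 8)%N -> killing_coef s y al be ga de mu nu et n = 0).
Proof.
move=> s_gt0 y_gt0; split=> [killing n range_n | coef0 p X _]; last first.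
  rewrite killing_lhs // big1_seq // => n; rewrite mem_index_iota => range_n.
  by rewrite coef0 // mulr0 scale0r.
have SU3_1 : @SU3 R 1%:M by split; rewrite ?det1 // mul1mx map_mx1 trmx1.
have := killing 1%:M (X_ s y n) SU3_1; rewrite killing_lhs //.
rewrite (bigD1_seq n) ?iota_uniq ?mem_index_iota //= big1_seq => [|m]; last first.
  rewrite mem_index_iota => /andP[/= neq_mn range_m].
  by rewrite g_frame // (eq_sym n) (negbTE neq_mn) mul0r scale0r.
rewrite g_frame // eqxx mul1r addr0.
have target_lt : ((target n).-1 < 8)%N.
  by case: n range_n => [|[|[|[|[|[|[|[|n]]]]]]]].
have target_gt0 : (0 < target n)%N.
  by case: n range_n {target_lt} => [|[|[|[|[|[|[|[|n]]]]]]]].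
move/matrixP/(_ (Ordinal target_lt) ord0); rewrite !mxE /= prednK // eqxx.
by rewrite mulr1.
Qed.

(** * The linear system *)

(** Once inverses of products are split, every equation is linear over the
    rationals in the unknowns and the quantities y, s^-1 and y * s^-1. *)
Lemma killing_coefs_eq0 (R : realType) (s y al be ga de mu nu et : R) :
  let q := 6^-1 + y / 12 + (y - 1) / (6 * s) in
  let m := 2 / 3 - 2 * y / 3 - (2 * y + 1) / (6 * s) in
  let r := 3^-1 - y / 3 - (4 - y) / (12 * s) in
  (forall n, (0 < n < 8)%N -> killing_coef s y al be ga de mu nu et n = 0) <->
  [/\ [/\ al = q, be = q, ga = q & de = - q], mu = m, nu = r & et = - r].
Proof.
rewrite /= !invfM; set u := s^-1.
split=> [c0 | [[-> -> -> ->] -> -> ->] n range_n].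
  have := (c0 1%N isT, c0 2%N isT, c0 3%N isT, c0 4%N isT, c0 5%N isT,
    c0 6%N isT, c0 7%N isT).
  rewrite /killing_coef /levi_civita_coef /torsion_coef !invfM -/u.
  case=> [[[[[[c1 c2] c3] c4] c5] c6] c7].
  by split; [split | | |]; lra.
rewrite /killing_coef /levi_civita_coef /torsion_coef !invfM -/u.
by case: n range_n => [|[|[|[|[|[|[|[|n]]]]]]]] // _; lra.
Qed.

Lemma form7_grouped (R : realType) (V : lmodType R) (q m r : R)
    (u1 u2 u3 u4 u5 u6 u7 : V) :
  q *: (u1 + u2 + u3 - u4) + m *: u5 + r *: (u6 - u7) =
  q *: u1 + q *: u2 + q *: u3 + (- q) *: u4 + m *: u5 + r *: u6 + (- r) *: u7.
Proof. by rewrite !scaleNr !scalerBr !scalerDr !addrA. Qed.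

Theorem proposition8p3 (R : realType) (s y : R) (s_gt0 : 0 < s) (y_gt0 : 0 < y) :
  let T5 : form3 R :=
    (6^-1 + y / 12 + (y - 1) / (6 * s)) *:
      (X3 s y 1 3 5 + X3 s y 1 4 6 + X3 s y 2 4 5 - X3 s y 2 3 6)
    + (2 / 3 - 2 * y / 3 - (2 * y + 1) / (6 * s)) *: X3 s y 1 2 7
    + (3^-1 - y / 3 - (4 - y) / (12 * s)) *: (X3 s y 3 4 7 - X3 s y 5 6 7) in
  algebraic_form3 s y T5 /\
  forall T : form3 R, algebraic_form3 s y T ->
    ((forall (p : 'M[R[i]]_3) (X : mvec R), SU3 p ->
        nabla s y X (psi5 R) p + cliff2 s y (interior_product X T) (psi5 R p) = 0)
     <-> T = T5).
Proof.
move=> T5.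
have T5E : T5 = form7 s y _ _ _ _ _ _ _ := form7_grouped _ _ _ _ _ _ _ _ _ _ _ _.
split; first by rewrite T5E; do 7! eexists.
move=> _ [al [be [ga [de [mu [nu [et ->]]]]]]].
rewrite -/(form7 s y al be ga de mu nu et) T5E.
split=> [/(killing_iff _ _ _ _ _ _ _ _ _ _ s_gt0 y_gt0)|->].
  by case/killing_coefs_eq0=> [[-> -> -> ->] -> -> ->].
by apply/killing_iff => //; apply/killing_coefs_eq0.
Qed.
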